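(* There exists a finitely generated subgroup $\Gamma \subset \mathcal{G}_\infty$ that admits no extension to $\mathrm{Homeo}_+(\mathbb{R})$; that is, there is no group homomorphism $\Phi: \Gamma \to \mathrm{Homeo}_+(\mathbb{R})$ such that $\pi(\Phi(\gamma)) = \gamma$ for all $\gamma \in \Gamma$.
   Context: $\mathrm{Homeo}_+(\mathbb{R})$ is the group (under composition) of orientation-preserving homeomorphisms of $\mathbb{R}$. The group of germs at infinity $\mathcal{G}_\infty$ is the set of equivalence classes of elements of $\mathrm{Homeo}_+(\mathbb{R})$ under the relation $f \sim g$ if $f$ and $g$ agree on some neighborhood $[x,\infty)$ of $\infty$, with the group operation induced by composition. The map $\pi: \mathrm{Homeo}_+(\mathbb{R}) \to \mathcal{G}_\infty$ is the natural quotient homomorphism sending a homeomorphism to its germ at infinity. *)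

(* Defs.v *)
From HB Require Import structures.
From mathcomp Require Import all_boot all_order all_algebra.
From mathcomp Require Import all_classical all_reals all_analysis.
From mathcomp Require Import generic_quotient.
Import Order.TTheory GRing.Theory Num.Theory.
Import numFieldNormedType.Exports.

Set Implicit Arguments.
Unset Strict Implicit.
Unset Printing Implicit Defensive.

Local Open Scope ring_scope.
Local Open Scope quotient_scope.

Definition homeomorphism (T U : topologicalType) (f : T -> U) : Prop :=
  continuous f /\
  exists g : U -> T, [/\ continuous g, cancel f g & cancel g f].

(* A homeomorphism of the line preserves orientation iff it is increasing. *)
Definition orientation_preserving (R : realType) (f : R -> R) : Prop :=
  {homo f : x y / x < y}.

(* The property is wrapped in a boolean so that equality of elements of
   [homeo R] is equality of the underlying functions. *)
Record homeo (R : realType) := Homeo {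
  homeo_fun :> R -> R;
  homeo_subproof : `[< homeomorphism homeo_fun /\
                       orientation_preserving homeo_fun >] }.

HB.instance Definition _ (R : realType) := [isSub for @homeo_fun R].
HB.instance Definition _ (R : realType) := [Choice of homeo R by <:].

Section HomeoGroup.
Context {R : realType}.
Implicit Types f g h : homeo R.

Lemma homeoP f : homeomorphism f /\ orientation_preserving f.
Proof. exact/asboolP/homeo_subproof. Qed.

Lemma homeo_ext f g : f =1 g -> f = g.
Proof. by move=> fg; apply/val_inj/funext. Qed.

Lemma homeo_id_subproof :
  `[< @homeomorphism R R idfun /\ @orientation_preserving R idfun >].
Proof.
apply/asboolP; split=> //; split; first by move=> x; exact: cvg_id.
by exists idfun; split=> // x; exact: cvg_id.
Qed.

Definition homeo_id : homeo R := Homeo homeo_id_subproof.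

Lemma homeo_comp_subproof f g :
  `[< homeomorphism (f \o g) /\ orientation_preserving (f \o g) >].
Proof.
have [[cf [f' [cf' fK f'K]]] hf] := homeoP f.
have [[cg [g' [cg' gK g'K]]] hg] := homeoP g.
apply/asboolP; split; last by move=> x y xy; apply/hf/hg.
split; first by move=> x; apply: continuous_comp; [exact: cg|exact: cf].
exists (g' \o f'); split.
- by move=> x; apply: continuous_comp; [exact: cf'|exact: cg'].
- by move=> x /=; rewrite fK gK.
- by move=> x /=; rewrite g'K f'K.
Qed.

Definition homeo_comp f g : homeo R := Homeo (homeo_comp_subproof f g).

Definition homeo_inv_fun f : R -> R := projT1 (cid (homeoP f).1.2).

Lemma homeo_inv_funP f :
  [/\ continuous (homeo_inv_fun f), cancel f (homeo_inv_fun f)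
    & cancel (homeo_inv_fun f) f].
Proof. by rewrite /homeo_inv_fun; case: cid. Qed.

Lemma homeo_inv_subproof f :
  `[< homeomorphism (homeo_inv_fun f) /\
      orientation_preserving (homeo_inv_fun f) >].
Proof.
have [[cf _] hf] := homeoP f.
have [cg fK gK] := homeo_inv_funP f.
apply/asboolP; split; first by split=> //; exists f.
by move=> x y xy; rewrite -(leW_mono (le_mono hf)) !gK.
Qed.

Definition homeo_inv f : homeo R := Homeo (homeo_inv_subproof f).

Lemma homeo_compA : associative homeo_comp.
Proof. by move=> f g h; exact: homeo_ext. Qed.

Lemma homeo_comp1f : left_id homeo_id homeo_comp.
Proof. by move=> f; exact: homeo_ext. Qed.

Lemma homeo_compf1 : right_id homeo_id homeo_comp.
Proof. by move=> f; exact: homeo_ext. Qed.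

Lemma homeo_compVf : left_inverse homeo_id homeo_inv homeo_comp.
Proof.
by move=> f; apply: homeo_ext => x /=; have [_ fK _] := homeo_inv_funP f.
Qed.

Lemma homeo_compfV : right_inverse homeo_id homeo_inv homeo_comp.
Proof.
by move=> f; apply: homeo_ext => x /=; have [_ _ gK] := homeo_inv_funP f.
Qed.

End HomeoGroup.

HB.instance Definition _ (R : realType) := isGroup.Build (homeo R)
  homeo_compA homeo_comp1f homeo_compf1 homeo_compVf homeo_compfV.

Section Germs.
Context {R : realType}.
Implicit Types f g h : homeo R.

Definition germ_equiv f g : bool :=
  `[< exists x : R, forall y : R, x <= y -> f y = g y >].

Lemma germ_equiv_refl : reflexive germ_equiv.
Proof. by move=> f; apply/asboolP; exists 0. Qed.

Lemma germ_equiv_sym : symmetric germ_equiv.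
Proof.
by move=> f g; apply/asboolP/asboolP => -[x xP]; exists x => y /xP.
Qed.

Lemma germ_equiv_trans : transitive germ_equiv.
Proof.
move=> g f h /asboolP[x fg] /asboolP[y gh]; apply/asboolP.
exists (Num.max x y) => z; rewrite ge_max => /andP[xz yz].
by rewrite fg// gh.
Qed.

Canonical germ_equiv_rel :=
  EquivRel germ_equiv germ_equiv_refl germ_equiv_sym germ_equiv_trans.

End Germs.

Definition germ (R : realType) := {eq_quot (@germ_equiv R)}.

HB.instance Definition _ (R : realType) := Choice.on (germ R).
HB.instance Definition _ (R : realType) := EqQuotient.on (germ R).

Definition germ_of (R : realType) (f : homeo R) : germ R := \pi_(germ R) f.

Section GermGroup.
Context {R : realType}.
Implicit Types (f g : homeo R) (a b c : germ R).

Lemma germ_ofP f g :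
  germ_of f = germ_of g <-> exists x : R, forall y : R, x <= y -> f y = g y.
Proof.
split; first by move=> /eqquotP/asboolP.
by move=> fg; apply/eqquotP/asboolP.
Qed.

Definition germ_one : germ R := germ_of 1%g.
Definition germ_mul a b : germ R := germ_of (repr a * repr b)%g.
Definition germ_inv a : germ R := germ_of (repr a)^-1%g.

Lemma germ_of_repr a : germ_of (repr a) = a.
Proof. exact: reprK. Qed.

Lemma germ_mulE f g : germ_mul (germ_of f) (germ_of g) = germ_of (f * g)%g.
Proof.
have /germ_ofP[x fE] := germ_of_repr (germ_of f).
have /germ_ofP[y gE] := germ_of_repr (germ_of g).
apply/germ_ofP; exists (Num.max y (homeo_inv g x)) => z.
rewrite ge_max => /andP[yz xz] /=; rewrite gE// fE//.
have [_ hg] := homeoP g; have [_ _ gK] := homeo_inv_funP g.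
by move: xz; rewrite -(le_mono hg) /= gK.
Qed.

Lemma germ_invE f : germ_inv (germ_of f) = germ_of f^-1%g.
Proof.
have /germ_ofP[x fE] := germ_of_repr (germ_of f).
apply/germ_ofP; exists (f x) => y xy /=.
have [_ hf] := homeoP f; have [_ _ fK] := homeo_inv_funP f.
have [_ rK _] := homeo_inv_funP (repr (germ_of f)).
by rewrite -[in LHS](fK y) -fE ?rK// -(le_mono hf) fK.
Qed.

Lemma germ_mulA : associative germ_mul.
Proof.
move=> a b c; rewrite -(germ_of_repr a) -(germ_of_repr b) -(germ_of_repr c).
by rewrite !germ_mulE mulgA.
Qed.

Lemma germ_mul1 : left_id germ_one germ_mul.
Proof. by move=> a; rewrite -(germ_of_repr a) germ_mulE mul1g. Qed.

Lemma germ_mulr1 : right_id germ_one germ_mul.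
Proof. by move=> a; rewrite -(germ_of_repr a) germ_mulE mulg1. Qed.

Lemma germ_mulV : left_inverse germ_one germ_inv germ_mul.
Proof. by move=> a; rewrite -(germ_of_repr a) germ_invE germ_mulE mulVg. Qed.

Lemma germ_mulrV : right_inverse germ_one germ_inv germ_mul.
Proof. by move=> a; rewrite -(germ_of_repr a) germ_invE germ_mulE mulgV. Qed.

End GermGroup.

HB.instance Definition _ (R : realType) := isGroup.Build (germ R)
  germ_mulA germ_mul1 germ_mulr1 germ_mulV germ_mulrV.

Lemma germ_ofM (R : realType) : {morph @germ_of R : f g / (f * g)%g}.
Proof. by move=> f g; rewrite -germ_mulE. Qed.

HB.instance Definition _ (R : realType) :=
  isMultiplicative.Build (homeo R) (germ R) (@germ_of R) (@germ_ofM R).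

Section Subgroups.
Context (G : groupType).

Definition subgroup_type (H : groupClosed G) := {x : G | x \in H}.

HB.instance Definition _ (H : groupClosed G) := SubChoice.on (subgroup_type H).

Lemma subgroup_type_closed (H : groupClosed G) : group_closed (fun x => x \in H).
Proof. by split; [exact: gpred1|move=> x y; exact: gpredF]. Qed.

HB.instance Definition _ (H : groupClosed G) :=
  SubChoice_isSubGroup.Build G _ (subgroup_type H) (subgroup_type_closed H).

(* H is the least subgroup containing some finite sequence s. *)
Definition finitely_generated (H : groupClosed G) : Prop :=
  exists s : seq G, {subset s <= H} /\
    forall K : groupClosed G, {subset s <= K} -> {subset H <= K}.

End Subgroups.

(* Main.v *)
Require Import Defs.
From HB Require Import structures.
From mathcomp Require Import all_boot all_order all_algebra.
From mathcomp Require Import all_classical all_reals all_analysis.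
From mathcomp Require Import zify lra.
Import Order.TTheory GRing.Theory Num.Theory.
Import numFieldNormedType.Exports.

(** Cut the half-line near infinity into the blocks [n, n + 1), and let a be
    the translation x |-> x + 1.  Let f and c be periodic maps acting on every
    block as fixed maps f0 and c0 of [0, 1], and let g act on the block n as
    f0 ^+ n * g0 * f0 ^- n for n >= 0; below, f0, c0, g0 are [block_f],
    [block_c], [block_g].  Then a commutes with f and with c, and the germ of
    a * f commutes with that of g.  The germs of a, f, c, g generate the group.

    The map f0 pushes the open unit interval to the right, with
    f0 (1/3) = 2/3, while c0 and g0 move only points of [1/3, 2/3].  So for
    n >= 1 the map f0 ^+ n * g0 * f0 ^- n moves only points to the right of
    2/3 and commutes with c0: the germs of c and g commute.  On the block 0,
    however, c acts as c0 and g as g0, and these are chosen not to commute.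

    In any group the four relations a f = f a, a c = c a, (a f) g = g (a f)
    and c g = g c imply that c commutes with f ^- n * g * f ^+ n for all n
    ([commute_conj_transfer]), because this conjugate equals
    a ^+ n * g * a ^- n.  As germs this is consistent: the neighbourhood of
    infinity on which c commutes with f ^- n * g * f ^+ n shrinks as n grows.
    For lifts to the line the commutation holds at every point.  If the lifts
    coincide with f, c, g beyond some n, then on the block n the lift of c
    acts as c0 and the lift of f ^- n * g * f ^+ n acts as
    f0 ^- n * (f0 ^+ n * g0 * f0 ^- n) * f0 ^+ n = g0, so c0 and g0 commute, a
    contradiction ([no_lift]). *)

Set Implicit Arguments.
Unset Strict Implicit.
Unset Printing Implicit Defensive.

Local Open Scope ring_scope.

(** * Finitely generated subgroups and an identity of group theory *)

Section GeneratedSubgroup.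
Context (G : groupType) (s : seq G).

Definition generated : {pred G} :=
  fun x => `[< forall K : groupClosed G, {subset s <= K} -> x \in K >].

Lemma generatedP x : reflect
  (forall K : groupClosed G, {subset s <= K} -> x \in K) (x \in generated).
Proof. exact: asboolP. Qed.

Lemma generated1 : 1%g \in generated.
Proof. by apply/generatedP => K _; exact: gpred1. Qed.

Lemma generatedM : mulg_closed generated.
Proof.
move=> x y /generatedP xs /generatedP ys; apply/generatedP => K sK.
by rewrite gpredM ?xs ?ys.
Qed.

Lemma generatedV : invg_closed generated.
Proof.
by move=> x /generatedP xs; apply/generatedP => K sK; rewrite gpredV xs.
Qed.

HB.instance Definition _ := isMulClosed.Build G generated generatedM.
HB.instance Definition _ := isMul1Closed.Build G generated generated1.
HB.instance Definition _ := isInvClosed.Build G generated generatedV.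

Definition subgroup_generated := GroupClosed.clone G generated _.

Lemma mem_subgroup_generated : {subset s <= subgroup_generated}.
Proof. by move=> x xs; apply/generatedP => K; apply. Qed.

Lemma subgroup_generated_fg : finitely_generated subgroup_generated.
Proof.
exists s; split; first exact: mem_subgroup_generated.
by move=> K sK x /generatedP; apply.
Qed.

End GeneratedSubgroup.

(** As a commutes with f, the powers of a * f split, and g, which commutes with
    them, satisfies f ^- n * g * f ^+ n = a ^+ n * g * a ^- n; every factor on
    the right commutes with c. *)
Lemma commute_conj_transfer (G : groupType) (a f c g : G) n :
  commute a f -> commute a c -> commute (a * f)%g g -> commute c g ->
  commute c (f ^- n * g * f ^+ n)%g.
Proof.
move=> af ac afg cg.
have -> : (f ^- n * g * f ^+ n = a ^+ n * g * a ^- n)%g.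
  have := commute_sym (commuteX n (commute_sym afg)); rewrite expgMn //.
  have afn : commute (a ^+ n)%g (f ^+ n)%g by exact: commuteX2.
  rewrite /commute afn => fag; apply: (mulgI (f ^+ n)%g).
  by rewrite !mulgA mulgV mul1g fag mulgA mulgK.
have can : commute c (a ^+ n)%g by apply/commuteX/commute_sym.
by do !apply: commuteM => //; apply: commuteV.
Qed.

(** * Homeomorphisms of the line *)

Section Homeos.
Context {R : realType}.
Implicit Types (f g h : homeo R) (phi psi : int -> homeo R) (x y : R).

Lemma homeo_lt f : {mono f : x y / x < y}.
Proof. exact: leW_mono (le_mono (homeoP f).2). Qed.

Lemma homeo_le f : {mono f : x y / x <= y}.
Proof. exact: le_mono (homeoP f).2. Qed.

Lemma homeoVK f : cancel f (f^-1)%g.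
Proof. by case: (homeo_inv_funP f). Qed.

Lemma homeoKV f : cancel (f^-1)%g f.
Proof. by case: (homeo_inv_funP f). Qed.

(** The preimage under u of the interval of radius e around u x is the open
    interval with endpoints v (u x - e) and v (u x + e). *)
Lemma increasing_bij_continuous (u v : R -> R) :
  {homo u : x y / x < y} -> cancel u v -> cancel v u -> continuous u.
Proof.
move=> uh uv vu x; have um := leW_mono (le_mono uh).
apply/cvgrPdist_lt => e e0; near=> t.
have t1 : v (u x - e) < t.
  by near: t; apply: lt_nbhsr; rewrite -um vu gtrBl.
have t2 : t < v (u x + e).
  by near: t; apply: lt_nbhsl; rewrite -um vu ltrDl.
rewrite -um vu in t1; rewrite -um vu in t2.
by rewrite ltr_norml; lra.
Unshelve. all: by end_near. Qed.

Lemma increasing_bij_homeo (u v : R -> R) :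
  {homo u : x y / x < y} -> cancel u v -> cancel v u ->
  `[< homeomorphism u /\ orientation_preserving u >].
Proof.
move=> uh uv vu; apply/asboolP; split=> //; split.
  exact: increasing_bij_continuous uh uv vu.
exists v; split=> //; apply: (increasing_bij_continuous _ vu uv).
by move=> x y xy; rewrite -(leW_mono (le_mono uh)) !vu.
Qed.

Definition increasing_homeo (u v : R -> R) (uh : {homo u : x y / x < y})
    (uv : cancel u v) (vu : cancel v u) : homeo R :=
  Homeo (increasing_bij_homeo uh uv vu).

(** Each map preserves the half-line on which it may be nontrivial, and there
    the other one is the identity. *)
Lemma commute_separated (s : R) g h :
  (forall x, x <= s -> g x = x) -> (forall x, s <= x -> h x = x) -> commute g h.
Proof.
move=> gs hs; apply: homeo_ext => x /=; case: (leP x s) => [xs|/ltW sx].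
  by rewrite !gs // -(hs s) // homeo_le.
by rewrite !hs // -(gs s) // homeo_le.
Qed.

Definition shift : homeo R.
Proof.
refine (@increasing_homeo (fun x => x + 1) (fun x => x - 1) _ _ _).
- by move=> x y; rewrite ltrD2r.
- by move=> x; rewrite addrK.
- by move=> x; rewrite subrK.
Defined.

(** A piecewise affine map pushing the open interval (l, r) to the right: slope
    2 from the fixed point l, then slope 1/2 up to the fixed point r; the
    maximum with x makes it the identity elsewhere. *)
Definition bump_fun (l r x : R) :=
  Num.max x (Num.min (2 * x - l) ((x + r) / 2)).

Definition bump_inv (l r y : R) :=
  Num.min y (Num.max ((y + l) / 2) (2 * y - r)).

Lemma bump_fun_lt l r : {homo bump_fun l r : x y / x < y}.
Proof.
move=> x y xy; rewrite /bump_fun.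
case: (leP (2 * x - l) ((x + r) / 2)) => ?; case: (leP x) => ?;
  case: (leP (2 * y - l) ((y + r) / 2)) => ?; case: (leP y) => ?; lra.
Qed.

Lemma bump_funK l r : l <= r -> cancel (bump_fun l r) (bump_inv l r).
Proof.
move=> lr x; rewrite /bump_inv /bump_fun.
case: (leP (2 * x - l) ((x + r) / 2)) => ?; case: (leP x) => ?;
  case: (leP ((_ + l) / 2)) => ?; case: leP => ?; lra.
Qed.

Lemma bump_invK l r : l <= r -> cancel (bump_inv l r) (bump_fun l r).
Proof.
move=> lr y; rewrite /bump_inv /bump_fun.
case: (leP ((y + l) / 2)) => ?; case: (leP y) => ?;
  case: (leP (2 * _ - l)) => ?; case: leP => ?; lra.
Qed.

Definition bump l r (lr : l <= r) : homeo R :=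
  increasing_homeo (@bump_fun_lt l r) (bump_funK lr) (bump_invK lr).

Lemma bump_ge l r (lr : l <= r) x : x <= bump lr x.
Proof. by rewrite /= /bump_fun le_max lexx. Qed.

Lemma bump_le_id l r (lr : l <= r) x : x <= l -> bump lr x = x.
Proof.
move=> ?; rewrite /= /bump_fun.
by case: (leP (2 * x - l) ((x + r) / 2)) => ?; case: (leP x) => ?; lra.
Qed.

Lemma bump_ge_id l r (lr : l <= r) x : r <= x -> bump lr x = x.
Proof.
move=> ?; rewrite /= /bump_fun.
by case: (leP (2 * x - l) ((x + r) / 2)) => ?; case: (leP x) => ?; lra.
Qed.

(** * Action of homeomorphisms on unit blocks *)

Definition fix01 : {pred homeo R} := fun h => (h 0 == 0) && (h 1 == 1).

Lemma fix01P h : reflect (h 0 = 0 /\ h 1 = 1) (h \in fix01).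
Proof. by apply: (iffP andP) => [[/eqP h0 /eqP h1]|[-> ->]]. Qed.

Lemma fix01_1 : 1%g \in fix01.
Proof. exact/fix01P. Qed.

Lemma fix01M : mulg_closed fix01.
Proof.
move=> g h /fix01P[g0 g1] /fix01P[h0 h1].
by apply/fix01P; rewrite /= h0 h1.
Qed.

Lemma fix01V : invg_closed fix01.
Proof.
move=> h /fix01P[h0 h1]; apply/fix01P.
by rewrite -[X in (h^-1)%g X = _]h0 -[X in _ /\ (h^-1)%g X = _]h1 !homeoVK.
Qed.

HB.instance Definition _ := isMulClosed.Build (homeo R) fix01 fix01M.
HB.instance Definition _ := isMul1Closed.Build (homeo R) fix01 fix01_1.
HB.instance Definition _ := isInvClosed.Build (homeo R) fix01 fix01V.

Lemma fix01_itv h x : h \in fix01 -> (0 <= h x < 1) = (0 <= x < 1).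
Proof.
by move=> /fix01P[h0 h1]; rewrite -[in LHS]h0 -[X in _ < X]h1 homeo_le homeo_lt.
Qed.

Lemma bump_fix01 l r (lr : l <= r) : 0 <= l -> r <= 1 -> bump lr \in fix01.
Proof. by move=> l0 r1; apply/fix01P; rewrite bump_le_id // bump_ge_id. Qed.

(** All maps of the construction permute the blocks [n, n + 1); this records
    the block m to which the block n is sent, and the map h of the unit
    interval by which this is done, so that relations between germs reduce to
    relations between homeomorphisms fixing 0 and 1. *)
Definition carries (h' : homeo R) (n m : int) (h : homeo R) :=
  forall x, 0 <= x < 1 -> h' (n%:~R + x) = m%:~R + h x.

Lemma carriesM f' g' n m k f g : g \in fix01 ->
  carries f' m k f -> carries g' n m g -> carries (f' * g')%g n k (f * g)%g.
Proof. by move=> g01 ff gg x x01 /=; rewrite gg // ff // fix01_itv. Qed.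

Lemma carriesV h' n m h : h \in fix01 ->
  carries h' n m h -> carries (h'^-1)%g m n (h^-1)%g.
Proof.
move=> h01 hh x x01; rewrite -[x in LHS](homeoKV h) -hh ?homeoVK //.
by rewrite fix01_itv // gpredV.
Qed.

Lemma carriesX h' n h k : h \in fix01 ->
  carries h' n n h -> carries (h' ^+ k)%g n n (h ^+ k)%g.
Proof.
move=> h01 hh; elim: k => [|k IHk]; first by [].
by rewrite !expgS; apply: carriesM IHk => //; apply: gpredXn.
Qed.

Lemma frac_itv x : 0 <= x - (Num.floor x)%:~R < 1.
Proof. by have := floor_itv x; rewrite intrD; lra. Qed.

Lemma carries_germ f g (N : int) :
  (forall n : int, N <= n -> exists m h, carries f n m h /\ carries g n m h) ->
  germ_of f = germ_of g.
Proof.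
move=> fg; apply/germ_ofP; exists N%:~R => y.
rewrite -floor_ge_int => /fg[m [h [fh gh]]].
by move: (fh _ (frac_itv y)) (gh _ (frac_itv y)); rewrite addrC subrK => -> ->.
Qed.

Lemma germ_carries f g : germ_of f = germ_of g -> exists N : nat,
  forall (n m : int) h, N%:Z <= n -> carries g n m h -> carries f n m h.
Proof.
move=> /germ_ofP[x fg]; exists (Num.bound `|x|) => n m h Nn gh y y01.
rewrite fg ?gh //; apply: le_trans (ler_norm x) _.
apply: le_trans (ltW (archi_boundP (normr_ge0 x))) _.
by move: Nn; rewrite -(ler_int R) pmulrn => Nn; move: y01; lra.
Qed.

Lemma shift_carries n : carries shift n (n + 1) 1%g.
Proof. by move=> x _ /=; rewrite intrD addrAC. Qed.

(** * Gluing maps of the unit interval along the blocks *)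

Section Glue.
Variables (phi : int -> homeo R).

Definition glue_fun (x : R) : R :=
  (Num.floor x)%:~R + phi (Num.floor x) (x - (Num.floor x)%:~R).

Hypothesis phi01 : forall n, phi n \in fix01.

Lemma glue_itv x : 0 <= glue_fun x - (Num.floor x)%:~R < 1.
Proof. by rewrite /glue_fun addrC addKr fix01_itv // frac_itv. Qed.

Lemma floor_glue x : Num.floor (glue_fun x) = Num.floor x.
Proof.
by apply: floor_def; have := glue_itv x; rewrite intrD; lra.
Qed.

(** Inside a block the glued map is increasing because its piece is; points of
    different blocks keep their order because each block is preserved. *)
Lemma glue_lt : {homo glue_fun : x y / x < y}.
Proof.
move=> x y xy; have : Num.floor x <= Num.floor y by rewrite le_floor // ltW.
rewrite le_eqVlt => /predU1P[fxy|].
  by rewrite /glue_fun fxy ltrD2l homeo_lt ltrD2r.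
rewrite -lezD1 -(ler_int R) intrD.
by move: (glue_itv x) (glue_itv y); lra.
Qed.

End Glue.

Lemma glue_funK phi psi : (forall n, phi n \in fix01) ->
  (forall n, cancel (phi n) (psi n)) -> cancel (glue_fun phi) (glue_fun psi).
Proof.
move=> phi01 phiK x; rewrite {1}/glue_fun floor_glue //.
have -> : glue_fun phi x - (Num.floor x)%:~R
    = phi (Num.floor x) (x - (Num.floor x)%:~R) by rewrite addrC addKr.
by rewrite phiK addrC subrK.
Qed.

Lemma glue_funVK phi : (forall n, phi n \in fix01) ->
  cancel (glue_fun (fun n => (phi n)^-1)%g) (glue_fun phi).
Proof.
by move=> phi01; apply: glue_funK => n; [rewrite gpredV|exact: homeoKV].
Qed.

Definition glue phi (phi01 : forall n, phi n \in fix01) : homeo R :=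
  increasing_homeo (glue_lt phi01)
    (glue_funK phi01 (fun n => homeoVK (phi n))) (glue_funVK phi01).

Lemma glue_carries phi (phi01 : forall n, phi n \in fix01) n :
  carries (glue phi01) n n (phi n).
Proof.
move=> x x01; have nx : Num.floor (n%:~R + x) = n.
  by apply: floor_def; rewrite intrD; lra.
by rewrite /= /glue_fun nx [n%:~R + x]addrC addrK.
Qed.

End Homeos.

(** * Four germs without a simultaneous lift *)

Section Counterexample.
Context {R : realType}.

Lemma le_third_two_thirds : 1 / 3 <= 2 / 3 :> R.
Proof. lra. Qed.

Lemma le_third_half : 1 / 3 <= 1 / 2 :> R.
Proof. lra. Qed.

Definition block_f : homeo R := bump ler01.
Definition block_c : homeo R := bump le_third_two_thirds.
Definition block_g : homeo R := bump le_third_half.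

Lemma block_f_fix01 : block_f \in fix01.
Proof. exact: bump_fix01. Qed.

Lemma block_c_fix01 : block_c \in fix01.
Proof. by apply: bump_fix01; lra. Qed.

Lemma block_g_fix01 : block_g \in fix01.
Proof. by apply: bump_fix01; lra. Qed.

(** The powers are indexed by the absolute value to avoid powers with negative
    exponents; germs at infinity are determined by the blocks n >= 0. *)
Definition conj_block_g (n : int) : homeo R :=
  (block_f ^+ `|n|%N * block_g * block_f ^- `|n|%N)%g.

Lemma conj_block_g_fix01 n : conj_block_g n \in fix01.
Proof.
have fn : (block_f ^+ `|n|%N)%g \in fix01 by apply: gpredXn block_f_fix01.
by rewrite gpredF // gpredM // block_g_fix01.
Qed.

Definition map_f : homeo R := glue (fun=> block_f_fix01).
Definition map_c : homeo R := glue (fun=> block_c_fix01).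
Definition map_g : homeo R := glue conj_block_g_fix01.

(** This is what makes the germ of the glued map commute with a * f, which sends
    the block k to the block k + 1 through block_f. *)
Lemma conj_block_gS (k : nat) :
  (block_f * conj_block_g k = conj_block_g (k%:Z + 1) * block_f)%g.
Proof.
by rewrite /conj_block_g -PoszD addn1 !absz_nat expgS invgM !mulgA mulgVK.
Qed.

(** The first step sends 1/3 to 2/3, and the following ones only increase. *)
Lemma block_f_expand k : 2 / 3 <= (block_f ^+ k.+1)%g (1 / 3) :> R.
Proof.
rewrite expgSr /=; have -> : bump_fun 0 1 (1 / 3 : R) = 2 / 3.
  by rewrite /bump_fun; case: (leP (2 * _ - 0)) => ?; case: leP => ?; lra.
elim: k => [|k IHk]; first by [].
by rewrite expgS; apply: le_trans IHk _; exact: bump_ge.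
Qed.

(** The point 2/3 separates the points moved by these two maps: those moved by
    the conjugate are the images under block_f ^+ k.+1 of points of
    (1/3, 1/2). *)
Lemma commute_block_c_conj (k : nat) : commute block_c (conj_block_g k.+1).
Proof.
apply/commute_sym/(@commute_separated _ (2 / 3)) => x xs.
  2: exact: bump_ge_id.
rewrite /conj_block_g absz_nat; set P := (block_f ^+ k.+1)%g.
have Px : (P^-1)%g x <= 1 / 3.
  by rewrite -(homeo_le P) homeoKV; apply: le_trans xs (block_f_expand k).
by rewrite -[RHS](homeoKV P); congr (P _); apply: bump_le_id.
Qed.

(** The point 1/2 is fixed by block_g, so if the two maps commuted then block_g
    would fix the preimage 5/12 of 1/2 under block_c; but 5/12 lies in
    (1/3, 1/2), where block_g moves every point. *)
Lemma block_c_g_noncommute :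
  block_c (block_g (5 / 12)) <> block_g (block_c (5 / 12)).
Proof.
have -> : block_g (5 / 12) = 11 / 24.
  rewrite /= /bump_fun.
  by case: (leP (2 * _ - _)) => ?; case: leP => ?; lra.
have -> : block_c (5 / 12) = 1 / 2.
  rewrite /= /bump_fun.
  by case: (leP (2 * _ - _)) => ?; case: leP => ?; lra.
rewrite (bump_ge_id le_third_half) // /= /bump_fun.
by case: (leP (2 * _ - _)) => ?; case: leP => ?; lra.
Qed.

Lemma germ_commute (f g : homeo R) (N : nat) :
  (forall k : nat, (N <= k)%N -> exists (m : int) h,
     carries (f * g)%g k m h /\ carries (g * f)%g k m h) ->
  commute (germ_of f) (germ_of g).
Proof.
move=> fg; rewrite /commute -!gmulfM; apply: (@carries_germ _ _ _ N).
by case=> // k; rewrite lez_nat => /fg.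
Qed.

Lemma germ_shift_periodic (h : homeo R) (h01 : h \in fix01) :
  commute (germ_of shift) (germ_of (glue (fun=> h01))).
Proof.
apply: (@germ_commute _ _ 0) => k _; exists (k%:Z + 1), h; split.
  rewrite -[X in carries _ _ _ X]mul1g.
  by apply: carriesM => //; [exact: shift_carries|exact: glue_carries].
rewrite -[X in carries _ _ _ X]mulg1.
by apply: carriesM; [exact: fix01_1|exact: glue_carries|exact: shift_carries].
Qed.

Lemma germ_shift_f_g :
  commute (germ_of shift * germ_of map_f)%g (germ_of map_g).
Proof.
rewrite -gmulfM; apply: (@germ_commute _ _ 0) => k _.
have af n : carries (shift * map_f)%g n (n + 1) block_f.
  rewrite -[block_f]mul1g; apply: carriesM block_f_fix01 (shift_carries _) _.
  exact: glue_carries.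
exists (k%:Z + 1), (block_f * conj_block_g k)%g; split.
  by apply: carriesM (af _) _; [exact: conj_block_g_fix01|exact: glue_carries].
rewrite conj_block_gS; apply: carriesM block_f_fix01 _ (af _).
exact: glue_carries.
Qed.

(** The commutation starts with the block 1 only: it fails on the block 0. *)
Lemma germ_c_g : commute (germ_of map_c) (germ_of map_g).
Proof.
apply: (@germ_commute _ _ 1) => -[//|k] _.
exists k.+1, (block_c * conj_block_g k.+1)%g.
split; last rewrite commute_block_c_conj.
  by apply: carriesM; [exact: conj_block_g_fix01|exact: glue_carries..].
by apply: carriesM; [exact: block_c_fix01|exact: glue_carries..].
Qed.

(** The lifts of f, c and g agree with these maps from some block n on.
    There the conjugate of G by F ^+ n undoes the conjugation in conj_block_g
    and acts as block_g, although it has to commute with C, which acts as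
    block_c. *)
Lemma no_lift (A F C G : homeo R) :
  commute A F -> commute A C -> commute (A * F)%g G -> commute C G ->
  germ_of F = germ_of map_f -> germ_of C = germ_of map_c ->
  germ_of G = germ_of map_g -> False.
Proof.
move=> AF AC AFG CG /germ_carries[NF Ff] /germ_carries[NC Cc].
move=> /germ_carries[NG Gg]; pose n := (NF + NC + NG)%N.
have Fn : carries F n n block_f by apply: Ff (glue_carries _ _); lia.
have Cn : carries C n n block_c by apply: Cc (glue_carries _ _); lia.
have Gn : carries G n n (conj_block_g n) by apply: Gg (glue_carries _ _); lia.
have Hn : carries (F ^- n * G * F ^+ n)%g n n block_g.
  have -> : block_g = (block_f ^- n * conj_block_g n * block_f ^+ n)%g.
    by rewrite /conj_block_g absz_nat !mulgA mulVg mul1g mulgVK.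
  have fXn := gpredXn n block_f_fix01; have FXn := carriesX n block_f_fix01 Fn.
  apply: (carriesM fXn _ FXn).
  by apply: carriesM Gn; [exact: conj_block_g_fix01|exact: carriesV fXn FXn].
have := commute_conj_transfer n AF AC AFG CG.
move=> /(congr1 (fun h : homeo R => h (n%:~R + 5 / 12))).
have x01 : 0 <= (5 / 12 : R) < 1 by lra.
rewrite (carriesM block_g_fix01 Cn Hn x01) (carriesM block_c_fix01 Hn Cn x01).
by move=> /addrI; apply: block_c_g_noncommute.
Qed.

End Counterexample.

Theorem proposition1p6 (R : realType) :
  exists Gamma : groupClosed (germ R),
    finitely_generated Gamma /\
    ~ exists Phi : {multiplicative subgroup_type Gamma -> homeo R},
        forall gamma : subgroup_type Gamma, germ_of (Phi gamma) = sval gamma.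
Proof.
pose s : seq (germ R) :=
  [:: germ_of shift; germ_of map_f; germ_of map_c; germ_of map_g].
exists (subgroup_generated s); split; first exact: subgroup_generated_fg.
case=> Phi PhiK.
have sG := @mem_subgroup_generated _ s.
pose gen x (xs : x \in s) : subgroup_type (subgroup_generated s) :=
  exist _ x (sG x xs).
have as_ : germ_of shift \in s by rewrite !inE eqxx ?orbT.
have fs : germ_of map_f \in s by rewrite !inE eqxx ?orbT.
have cs : germ_of map_c \in s by rewrite !inE eqxx ?orbT.
have gs : germ_of map_g \in s by rewrite !inE eqxx ?orbT.
apply: (@no_lift R (Phi (gen _ as_)) (Phi (gen _ fs)) (Phi (gen _ cs))
  (Phi (gen _ gs))); rewrite ?PhiK //.
- by apply/gmulf_commute/val_inj/germ_shift_periodic.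
- by apply/gmulf_commute/val_inj/germ_shift_periodic.
- by rewrite -gmulfM; apply/gmulf_commute/val_inj/germ_shift_f_g.
- by apply/gmulf_commute/val_inj/germ_c_g.
Qed.
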